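(* Let $(M,H)$ be a Hamilton space with Hamiltonian vector field $\rho_H$ and adapted tangent structure $\mathcal{J}_H$, and let $\mathcal{N}=-\mathcal{L}_{\rho_H}\mathcal{J}_H$ be the canonical nonlinear connection. Let $\nabla$ be the dynamical covariant derivative and $\Phi$ the Jacobi endomorphism induced by $\rho_H$ and $\mathcal{N}$. Then a vector field $X\in\mathcal{X}(T^{*}M\setminus\{0\})$ is an infinitesimal symmetry of $\rho_H$ if and only if $X$ is a Newtonoid vector field and satisfies $$\nabla^2\mathcal{J}_HX+\Phi(X)=0.$$ In local coordinates, with $X=X^i\frac{\partial}{\partial x^i}+Y_i\frac{\partial}{\partial p_i}$, this last equation reads $$\nabla^2\left(g_{ij}X^i\frac{\partial}{\partial p_j}\right)+\mathcal{R}_{ij}X^i\frac{\partial}{\partial p_j}=0 .$$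
   Context: Hamilton space: $M$ is a smooth $n$-dimensional manifold and $H:T^{*}M\to\mathbb{R}$ is smooth on $T^{*}M\setminus\{0\}$ (zero section removed), continuous on the zero section, with $g^{ij}=\frac{\partial^2H}{\partial p_i\partial p_j}$ of rank $n$ and constant signature on $T^{*}M\setminus\{0\}$, in induced coordinates $(x^i,p_i)$; $(g_{ij})$ is the inverse matrix. All structures are considered on $T^{*}M\setminus\{0\}$. Adapted tangent structure: $\mathcal{J}_H=g_{ij}\,dx^i\otimes\frac{\partial}{\partial p_j}$, i.e. $\mathcal{J}_H(\partial/\partial x^i)=g_{ij}\,\partial/\partial p_j$, $\mathcal{J}_H(\partial/\partial p_i)=0$. Hamiltonian vector field: $\rho_H=\frac{\partial H}{\partial p_i}\frac{\partial}{\partial x^i}-\frac{\partial H}{\partial x^i}\frac{\partial}{\partial p_i}$, the vector field with $i_{\rho_H}\omega=-dH$, where $\omega=dp_i\wedge dx^i$. Nonlinear connection: a $(1,1)$-tensor field $\mathcal{N}$ with $\mathcal{N}^2=\mathrm{Id}$ and $\ker(\mathrm{Id}+\mathcal{N})$ equal to the vertical distribution spanned by $\partial/\partial p_i$; $h=\frac12(\mathrm{Id}+\mathcal{N})$, $v=\frac12(\mathrm{Id}-\mathcal{N})$. Here $(\mathcal{L}_{\rho_H}T)(X)=[\rho_H,TX]-T[\rho_H,X]$ for a $(1,1)$-tensor field $T$, and $-\mathcal{L}_{\rho_H}\mathcal{J}_H$ is a nonlinear connection. Dynamical covariant derivative on vector fields: $\nabla X=h[\rho_H,hX]+v[\rho_H,vX]$;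 $\nabla^2=\nabla\circ\nabla$, and $\nabla^2\mathcal{J}_HX$ means $\nabla(\nabla(\mathcal{J}_HX))$. Jacobi endomorphism: $\Phi=v\circ\mathcal{L}_{\rho_H}h$; its local components $\mathcal{R}_{ij}$ are defined by $\Phi=\mathcal{R}_{ij}\,dx^i\otimes\frac{\partial}{\partial p_j}$. Infinitesimal symmetry of $\rho_H$: a vector field $X$ with $[\rho_H,X]=0$. Newtonoid vector field: a vector field $X$ with $\mathcal{J}_H[\rho_H,X]=0$. *)

(* Defs.v *)
From HB Require Import structures.
From mathcomp Require Import all_boot all_order all_algebra.
From mathcomp Require Import all_classical all_reals all_analysis.
Import Order.TTheory GRing.Theory Num.Theory.
Import numFieldNormedType.Exports.

Set Implicit Arguments.
Unset Strict Implicit.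
Unset Printing Implicit Defensive.

Local Open Scope classical_set_scope.
Local Open Scope ring_scope.

(** * Smooth maps *)

(** [D] is meant to be open and [V] finite-dimensional.  [class_C k] asks for
    [k]-fold differentiability with continuous [k]-th directional derivatives;
    for all [k] together this is the usual class C^oo. *)

Section Smooth.
Context {R : realType} {V W : normedModType R}.

Fixpoint class_C (k : nat) (D : set V) (f : V -> W) : Prop :=
  if k is k'.+1 then
    (forall z, D z -> differentiable f z) /\
    (forall v : V, class_C k' D ('D_v f))
  else forall z, D z -> {for z, continuous f}.

Definition smooth_on (D : set V) (f : V -> W) : Prop :=
  forall k, class_C k D f.

End Smooth.

(** * Charts *)

(** A family of charts, without axioms.  Each [chart_map c] is only meaningful
    on [chart_dom c], and is intended to be injective there. *)
Record charts (R : realType) (V : normedModType R) (N : Type) := Charts {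
  chart : Type;
  chart_dom : chart -> set N;
  chart_map : chart -> N -> V
}.

Section ChartTheory.
Context {R : realType} {V : normedModType R} {N : Type}.
Variable A : charts V N.

Definition chart_img (c : chart A) : set V := chart_map c @` chart_dom c.

(** [f] read in the chart [c], that is [f \o (chart_map c)^-1]; it is [0]
    outside [chart_img c]. *)
Definition in_chart {W : normedModType R} (c : chart A) (f : N -> W) : V -> W :=
  fun z => xget 0 [set f u | u in chart_dom c `&` chart_map c @^-1` [set z]].

Definition transition (c d : chart A) : V -> V := in_chart c (chart_map d).

Definition smooth_fun {W : normedModType R} (f : N -> W) : Prop :=
  forall c : chart A, smooth_on (chart_img c) (in_chart c f).

(** A vector field is given by its components in every chart, as functions of
    the coordinates: [X c z] is the component vector of [X], in the chart [c],
    at the point with coordinates [z].  Only the values at [z] in [chart_img c]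
    are meaningful.  The operators below act chart by chart, so they may also
    be applied to fields defined in a single chart, such as coordinate
    fields. *)
Definition field : Type := chart A -> V -> V.

Definition vector_field (X : field) : Prop :=
  (forall c, smooth_on (chart_img c) (X c)) /\
  (forall c d u, chart_dom c u -> chart_dom d u ->
     X d (chart_map d u) =
     'D_(X c (chart_map c u)) (transition c d) (chart_map c u)).

Definition vanishes (X : field) : Prop :=
  forall c z, chart_img c z -> X c z = 0.

Definition fadd (X Y : field) : field := fun c z => X c z + Y c z.
Definition fopp (X : field) : field := fun c z => - X c z.
Definition fscale (a : R) (X : field) : field := fun c z => a *: X c z.

(** [[X, Y]^a = X^b (d Y^a / d z^b) - Y^b (d X^a / d z^b)]. *)
Definition lie_bracket (X Y : field) : field :=
  fun c z => 'D_(X c z) (Y c) z - 'D_(Y c z) (X c) z.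

(** (1,1)-tensor fields are represented by their action on vector fields. *)
Definition lie_derivative (rho : field) (T : field -> field) (X : field)
    : field :=
  fadd (lie_bracket rho (T X)) (fopp (T (lie_bracket rho X))).

Definition horizontal_projector (N : field -> field) (X : field) : field :=
  fscale 2^-1 (fadd X (N X)).

Definition vertical_projector (N : field -> field) (X : field) : field :=
  fscale 2^-1 (fadd X (fopp (N X))).

Definition dynamical_derivative (rho : field) (N : field -> field)
    (X : field) : field :=
  let h := horizontal_projector N in
  let v := vertical_projector N in
  fadd (h (lie_bracket rho (h X))) (v (lie_bracket rho (v X))).

Definition jacobi_endomorphism (rho : field) (N : field -> field)
    (X : field) : field :=
  vertical_projector N (lie_derivative rho (horizontal_projector N) X).

Definition infinitesimal_symmetry (rho X : field) : Prop :=
  vanishes (lie_bracket rho X).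

Definition newtonoid (rho : field) (J : field -> field) (X : field) : Prop :=
  vanishes (J (lie_bracket rho X)).

End ChartTheory.

Arguments field {R V N} A.

(** * Smooth manifolds *)

(** The charts need not form a maximal atlas: smoothness of functions and
    vector fields can be tested on any atlas. *)
Record smooth_manifold (R : realType) (n : nat) := SmoothManifold {
  carrier :> topologicalType;
  atlas : charts 'rV[R]_n carrier;
  carrier_hausdorff : hausdorff_space carrier;
  carrier_second_countable : @second_countable carrier;
  atlas_cover : forall x, exists c : chart atlas, chart_dom c x;
  atlas_open : forall c : chart atlas, open (chart_dom c);
  atlas_inj : forall c : chart atlas, set_inj (chart_dom c) (chart_map c);
  atlas_continuous : forall (c : chart atlas) x, chart_dom c x ->
    {for x, continuous (chart_map c)};
  atlas_open_map : forall (c : chart atlas) (U : set carrier),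
    open U -> U `<=` chart_dom c -> open (chart_map c @` U);
  atlas_smooth : forall c d : chart atlas,
    smooth_on (chart_map c @` (chart_dom c `&` chart_dom d)) (transition c d)
}.

(** * The cotangent bundle *)

Section Cotangent.
Context {R : realType} {n : nat}.
Variable M : smooth_manifold R n.

(** A covector is given by its components in the charts around its base point,
    with [p_a = (d x'^b / d x^a) p'_b] under a change of chart. *)
Record cotangent := Cotangent {
  base : M;
  momentum : chart (atlas M) -> 'rV[R]_n;
  momentum_transition : forall c d, chart_dom c base -> chart_dom d base ->
    forall a : 'I_n, momentum c 0 a =
      \sum_(b < n)
        'D_(delta_mx 0 a) (transition c d) (chart_map c base) 0 b
        * momentum d 0 b;
  (* normalization, so that a covector has a unique representation *)
  momentum_out : forall c, ~ chart_dom c base -> momentum c = 0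
}.

(** Induced charts, with coordinates [(x, p)]. *)
Definition cotangent_charts : charts ('rV[R]_n * 'rV[R]_n)%type cotangent :=
  Charts (fun c : chart (atlas M) => [set u | chart_dom c (base u)])
         (fun c u => (chart_map c (base u), momentum u c)).

(** The same charts on the cotangent bundle without its zero section. *)
Definition slit_charts : charts ('rV[R]_n * 'rV[R]_n)%type cotangent :=
  Charts (fun c : chart (atlas M) =>
            [set u | chart_dom c (base u) /\ momentum u c != 0])
         (fun c u => (chart_map c (base u), momentum u c)).

End Cotangent.

Section Hamilton.
Context {R : realType} {n : nat}.

(** The coordinate vectors [d/dx^i] and [d/dp_i]. *)
Definition ddx (i : 'I_n) : 'rV[R]_n * 'rV[R]_n := (delta_mx 0 i, 0).
Definition ddp (i : 'I_n) : 'rV[R]_n * 'rV[R]_n := (0, delta_mx 0 i).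

(** The symmetric matrix [S] is congruent to the diagonal matrix with [p]
    entries [1], [q] entries [-1], and the other diagonal entries [0]. *)
Definition has_signature (S : 'M[R]_n) (p q : nat) : Prop :=
  (p + q <= n)%N /\
  exists2 P : 'M[R]_n, P \in unitmx &
    P *m S *m P^T =
    diag_mx (\row_(i < n) if (i < p)%N then 1
                          else if (i < p + q)%N then -1 else 0).

Variable M : smooth_manifold R n.
Local Notation V := ('rV[R]_n * 'rV[R]_n)%type.

Definition g_up (H : cotangent M -> R) (c : chart (slit_charts M)) (z : V)
    : 'M[R]_n :=
  \matrix_(i, j) 'D_(ddp i) ('D_(ddp j) (in_chart c (H : _ -> R^o))) z.

Definition g_down (H : cotangent M -> R) (c : chart (slit_charts M)) (z : V)
    : 'M[R]_n :=
  invmx (g_up H c z).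

Record hamilton_space (H : cotangent M -> R) : Prop := HamiltonSpace {
  hamilton_smooth : smooth_fun (slit_charts M) (H : _ -> R^o);
  hamilton_continuous : forall (c : chart (cotangent_charts M)) u,
    chart_dom c u -> momentum u c = 0 ->
    {for chart_map c u, continuous (in_chart c (H : _ -> R^o))};
  hamilton_rank : forall c z, chart_img c z -> \rank (g_up H c z) = n;
  hamilton_signature : exists p q : nat,
    forall c z, chart_img c z -> has_signature (g_up H c z) p q
}.

Definition tangent_structure (H : cotangent M -> R)
    (X : field (slit_charts M)) : field (slit_charts M) :=
  fun c z => \sum_(i < n) \sum_(j < n)
    (g_down H c z i j * (X c z).1 0 i) *: ddp j.

Definition hamiltonian_field (H : cotangent M -> R) : field (slit_charts M) :=
  fun c z => let Hc := in_chart c (H : _ -> R^o) in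
    \sum_(i < n) ('D_(ddp i) Hc z *: ddx i - 'D_(ddx i) Hc z *: ddp i).

Definition canonical_connection (H : cotangent M -> R)
    (X : field (slit_charts M)) : field (slit_charts M) :=
  fopp (lie_derivative (hamiltonian_field H) (tangent_structure H) X).

(** [jacobi_coef Phi c z i j] is the [d/dp_j] component, in the chart [c], of
    the image of the coordinate field [d/dx^i] under [Phi]. *)
Definition jacobi_coef
    (Phi : field (slit_charts M) -> field (slit_charts M))
    (c : chart (slit_charts M)) (z : V) (i j : 'I_n) : R :=
  (Phi (fun _ _ => ddx i) c z).2 0 j.

End Hamilton.

(* Main.v *)
Require Import Defs.
From HB Require Import structures.
From mathcomp Require Import all_boot all_order all_algebra.
From mathcomp Require Import all_classical all_reals all_analysis.
Import Order.TTheory GRing.Theory Num.Theory.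
Import numFieldNormedType.Exports.

(** Everything happens in one chart, on the set of coordinates of nonzero
    covectors.  This set is open ([open_slit_chart_img]), so that derivatives
    of fields are determined by their values on it.

    Write L for the Lie derivative along rho, J for the tangent structure,
    N = J L - L J for the connection, h and v for its projectors.  A field is
    vertical when J kills it.  One identity ties H to J: J L V = - V for every
    vertical V.  Indeed the x-part of L V is minus the derivative of dH/dp in
    the direction V, which is g^{ij} applied to V ([bracket_vertical]), and J
    applies the inverse matrix.  With J J = 0, the locality of L and its Leibniz
    rule, it gives that N is tensorial, equals - Id on vertical fields and
    satisfies J N = J; so v is a projector onto the vertical fields, v h = 0
    and h + v = Id.

    Suppose that X is Newtonoid, that is, L X is vertical.  Then N X = - L J X,
    so L J X = v X - h X and nabla (J X) = v L J X = v X, as J X is vertical.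
    Hence nabla (nabla (J X)) = v L v X.  Since v h = 0, the Jacobi endomorphism
    is Phi X = v L h X ([jacobiE]).  The sum is v L (v X + h X) = v L X = L X.
    So, on Newtonoid fields, the left-hand side of the equation is
    the bracket of rho and X itself ([second_derivative_newtonoid]), and the
    equivalence follows, since symmetries are Newtonoid.

    For the local formula, Phi = v L h is linear over smooth functions: the
    Leibniz term rho(a) h X is killed by v.  It also kills vertical fields, so
    Phi X is the combination of the Phi (d/dx^i) with the coefficients X^i of X
    ([jacobi_components]). *)

Set Implicit Arguments.
Unset Strict Implicit.
Unset Printing Implicit Defensive.

Local Open Scope classical_set_scope.
Local Open Scope ring_scope.

(** * Smooth maps on an open set *)
Section Calculus.
Context {R : realType} {V W : normedModType R}.
Implicit Types (D : set V) (f g : V -> W).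

(** [f] and [g] have the same first-order expansion at [z], and this expansion
    determines the differential. *)
Lemma near_eq_differentiable f g z :
  (\forall x \near z, f x = g x) -> differentiable f z -> differentiable g z.
Proof.
move=> fg df; have fgz : f z = g z by exact: (nbhs_singleton fg).
have cd : continuous ('d f z) by exact: diff_continuous.
have E : g \o shift z = cst (g z) + 'd f z +o_ 0 id.
  apply/eqaddoP => e e0.
  move/diff_locally: df => /eqaddoP /(_ e e0) H.
  have fg0 : \forall x \near 0, f (x + z) = g (x + z).
    by move: fg; rewrite (near_shift 0 z) /=; apply: filterS => x /=; rewrite subr0.
  near=> x.
  have -> : (g \o shift z - (cst (g z) + 'd f z)) x
          = (f \o shift z - (cst (f z) + 'd f z)) x.
    rewrite !fctE /= -fgz; congr (_ - _); apply/esym; near: x; exact: fg0.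
  by near: x.
apply/diff_locallyP; rewrite (diff_unique cd E); split => //.
Unshelve. all: by end_near. Qed.

Lemma near_open D z (P : V -> Prop) : open D -> D z ->
  (forall x, D x -> P x) -> \forall x \near z, P x.
Proof. by move=> oD Dz H; apply: filterS (open_nbhs_nbhs (conj oD Dz)). Qed.

Lemma derive_eq_on D f g z v : open D -> D z ->
  (forall x, D x -> f x = g x) -> 'D_v f z = 'D_v g z.
Proof. by move=> oD Dz fg; apply: near_eq_derive; apply: near_open fg. Qed.

Lemma class_C_eq_on k D f g : open D -> (forall x, D x -> f x = g x) ->
  class_C k D f -> class_C k D g.
Proof.
move=> oD; elim: k f g => [|k IH] f g fg /=.
  move=> cf z Dz; have E : \forall x \near z, f x = g x by exact: near_open fg.
  have := cf _ Dz; rewrite /prop_for /continuous_at (fg _ Dz).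
  by apply: cvg_trans; apply: near_eq_cvg.
case=> df Df; split=> [z Dz|v].
  by apply: near_eq_differentiable (df _ Dz); apply: near_open fg.
by apply: IH (Df v) => z Dz; apply: derive_eq_on fg.
Qed.

Lemma class_C_le k D f : class_C k.+1 D f -> class_C k D f.
Proof.
elim: k f => [|k IH] f /=.
  by case=> df _ z Dz; apply: differentiable_continuous; exact: df.
by case=> df Df; split=> // v; apply: IH; exact: Df.
Qed.

Lemma class_C_cst k D (w : W) : class_C k D (cst w).
Proof.
elim: k w => [|k IH] w /=; first by move=> z _; exact: cvg_cst.
split=> [z _|v]; first exact: differentiable_cst.
have -> : 'D_v (cst w) = cst 0 :> (V -> W) by apply/funext => z; exact: derive_cst.
exact: IH.
Qed.

Lemma class_C_add k D f g : open D -> class_C k D f -> class_C k D g ->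
  class_C k D (fun z => f z + g z).
Proof.
move=> oD; elim: k f g => [|k IH] f g /=.
  by move=> cf cg z Dz; apply: continuousD; [exact: cf|exact: cg].
case=> df Df [dg Dg]; split=> [z Dz|v].
  by apply: differentiableD; [exact: df|exact: dg].
apply: class_C_eq_on (IH _ _ (Df v) (Dg v)) => // z Dz; apply/esym.
by apply: deriveD; apply: diff_derivable; [exact: df|exact: dg].
Qed.

Lemma class_C_sum k D (I : Type) (r : seq I) (F : I -> V -> W) : open D ->
  (forall i, class_C k D (F i)) -> class_C k D (fun z => \sum_(i <- r) F i z).
Proof.
move=> oD CF; elim: r => [|i r IH].
  by under eq_fun do rewrite big_nil; exact: class_C_cst.
by under eq_fun do rewrite big_cons; exact: class_C_add.
Qed.

Lemma smooth_derive D f v : smooth_on D f -> smooth_on D ('D_v f).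
Proof. by move=> sf k; have /= [_] := sf k.+1; apply. Qed.

Lemma smooth_differentiable D f z : smooth_on D f -> D z -> differentiable f z.
Proof. by move=> sf; have /= [df _] := sf 1%N; exact: df. Qed.

Lemma smooth_eq_on D f g : open D -> (forall x, D x -> f x = g x) ->
  smooth_on D f -> smooth_on D g.
Proof. by move=> oD fg sf k; exact: class_C_eq_on (sf k). Qed.

End Calculus.

Lemma derive_comp (R : numFieldType) (U V W : normedModType R)
    (f : U -> V) (g : V -> W) z v :
  differentiable f z -> differentiable g (f z) ->
  'D_v (g \o f) z = 'D_('D_v f z) g (f z).
Proof.
move=> df dg; have dc : differentiable (g \o f) z by exact: differentiable_comp.
by rewrite !deriveE// diff_comp.
Qed.

Section CalculusLinear.
Context {R : realType} {V W U : normedModType R}.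

Lemma derive_linear (L : W -> U) (f : V -> W) z v : linear L -> continuous L ->
  differentiable f z ->
  differentiable (fun x => L (f x)) z /\
  'D_v (fun x => L (f x)) z = L ('D_v f z).
Proof.
move=> lL cL df.
pose LM := GRing.isLinear.Build _ _ _ _ _ lL.
pose LL : {linear W -> U} := HB.pack L LM.
have dL : differentiable LL (f z) by exact: linear_differentiable.
have dc : differentiable (LL \o f) z by exact: differentiable_comp.
split=> //; rewrite -[fun x => _]/(LL \o f) !deriveE// diff_comp//=.
by have -> : 'd L (f z) = L :> (W -> U) by exact: (@diff_lin _ _ _ LL).
Qed.

Lemma class_C_linear k (D : set V) (L : W -> U) (f : V -> W) : open D ->
  linear L -> continuous L -> class_C k D f -> class_C k D (fun z => L (f z)).
Proof.
move=> oD lL cL; elim: k f => [|k IH] f /=.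
  by move=> cf z Dz; apply: continuous_comp; [exact: cf|exact: cL].
case=> df Df; split=> [z Dz|v].
  by have [] := derive_linear 0 lL cL (df z Dz).
apply: class_C_eq_on (IH _ (Df v)) => // z Dz; apply/esym.
by have [] := derive_linear v lL cL (df z Dz).
Qed.

Lemma scale_is_bilinear :
  bilinear_for
    (GRing.Scale.Law.clone _ _ *:%R _) (GRing.Scale.Law.clone _ _ *:%R _)
    (@GRing.scale R W : R^o -> W -> W).
Proof.
split=> [w|a] b x y /=.
- by rewrite scalerDl scalerA.
- by rewrite scalerDr !scalerA mulrC.
Qed.

Lemma derive_scale (a : V -> R^o) (f : V -> W) z v :
  differentiable a z -> differentiable f z ->
  differentiable (fun x => a x *: f x) z /\
  'D_v (fun x => a x *: f x) z = 'D_v a z *: f z + a z *: 'D_v f z.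
Proof.
move=> da df.
pose BM := bilinear_isBilinear.Build R R^o W W _ _ (@GRing.scale R W) scale_is_bilinear.
pose B : {bilinear R^o -> W -> W} := HB.pack (@GRing.scale R W : R^o -> W -> W) BM.
have cB : continuous (fun p : R^o * W => B p.1 p.2) by move=> p; exact: scale_continuous.
have dB := differentiable_bilin (a z, f z) cB.
have dp : differentiable (fun x => (a x, f x)) z by exact: differentiable_pair.
have dc : differentiable ((fun p : R^o * W => B p.1 p.2) \o (fun x => (a x, f x))) z.
  exact: differentiable_comp.
split; first exact: dc.
rewrite -[LHS]/('D_v ((fun p : R^o * W => B p.1 p.2) \o (fun x => (a x, f x))) z).
rewrite !deriveE// diff_comp// /comp diff_pair//.
have -> : 'd (fun p : R^o * W => B p.1 p.2) (a z, f z) =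
    (fun q => B (a z) q.2 + B q.1 (f z)) :> (R^o * W -> W).
  exact: (diff_bilin (a z, f z) cB).
by rewrite addrC.
Qed.

Lemma class_C_scale k (D : set V) (a : V -> R^o) (f : V -> W) : open D ->
  class_C k D a -> class_C k D f -> class_C k D (fun z => a z *: f z).
Proof.
move=> oD; elim: k a f => [|k IH] a f.
  move=> /= ca cf z Dz; apply: continuousZ; [exact: ca|exact: cf].
move=> Ca Cf; case: (Ca) => da Da; case: (Cf) => df Df; split=> [z Dz|v].
  by have [] := derive_scale 0 (da z Dz) (df z Dz).
have C1 := IH _ _ (Da v) (class_C_le Cf).
have C2 := IH _ _ (class_C_le Ca) (Df v).
apply: class_C_eq_on (class_C_add oD C1 C2) => // z Dz; apply/esym.
by have [] := derive_scale v (da z Dz) (df z Dz).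
Qed.

End CalculusLinear.

Section CalculusScalar.
Context {R : realType} {V : normedModType R}.

(** The induction closes because the derivative of the inverse of [a] is again
    a product of inverses of [a] with a derivative of [a]. *)
Lemma class_C_inv k (D : set V) (a : V -> R^o) : open D ->
  (forall z, D z -> a z != 0) -> class_C k D a ->
  class_C k D (fun z => (a z)^-1 : R^o).
Proof.
move=> oD a0; elim: k => [|k IH].
  by move=> /= ca z Dz; apply: cvgV; [exact: a0|exact: ca].
move=> Ca; case: (Ca) => da Da; split=> [z Dz|v].
  by apply: (@differentiableV _ _ (a : V -> R)); [exact: da|exact: a0].
have Ci := IH (class_C_le Ca).
have C2 : class_C k D (fun z => (-1 : R^o) *: ((a z)^-1 *: ((a z)^-1 *: 'D_v a z)) : R^o).
  apply: class_C_scale => //; first exact: class_C_cst.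
  by do 2![apply: class_C_scale => //]; exact: Da.
apply: class_C_eq_on C2 => // z Dz; apply/esym.
rewrite (@deriveV _ _ (a : V -> R)); [|exact: a0|exact/diff_derivable/da].
by rewrite !scalerA -expr2 exprVn mulN1r.
Qed.

Lemma class_C_prod k (D : set V) (I : Type) (r : seq I) (F : I -> V -> R^o) :
  open D -> (forall i, class_C k D (F i)) ->
  class_C k D (fun z => \prod_(i <- r) (F i z : R) : R^o).
Proof.
move=> oD CF; elim: r => [|i r IH].
  by under eq_fun do rewrite big_nil; exact: class_C_cst.
under eq_fun do rewrite big_cons; exact: class_C_scale.
Qed.

Lemma class_C_det k (D : set V) m (A : V -> 'M[R]_m) : open D ->
  (forall i j, class_C k D (fun z => A z i j : R^o)) ->
  class_C k D (fun z => \det (A z) : R^o).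
Proof.
move=> oD CA; rewrite /determinant; apply: class_C_sum => // s.
apply: (@class_C_scale _ _ R^o) => //; first exact: class_C_cst.
exact: class_C_prod.
Qed.

(** Cramer's formula writes the entries of the inverse with determinants,
    which are polynomial in the entries. *)
Lemma class_C_invmx k (D : set V) m (A : V -> 'M[R]_m) i j : open D ->
  (forall z, D z -> A z \in unitmx) ->
  (forall i j, class_C k D (fun z => A z i j : R^o)) ->
  class_C k D (fun z => invmx (A z) i j : R^o).
Proof.
move=> oD uA CA.
have C : class_C k D (fun z => (\det (A z))^-1 *: (cofactor (A z) j i : R^o) : R^o).
  apply: class_C_scale => //.
    apply: class_C_inv => //; last exact: class_C_det.
    by move=> z Dz; have := uA z Dz; rewrite unitmxE unitfE.
  apply: (@class_C_scale _ _ R^o) => //; first exact: class_C_cst.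
  apply: class_C_det => // a b; under eq_fun do rewrite !mxE; exact: CA.
apply: class_C_eq_on C => // z Dz; rewrite /invmx uA// !mxE.
by [].
Qed.

End CalculusScalar.

(** * The coordinates of nonzero covectors form an open set *)
Section SlitImage.
Context {R : realType} {n : nat}.
Variable M : smooth_manifold R n.
Implicit Types (c d e : chart (atlas M)) (x : M).

Lemma transitionE c d x : chart_dom c x ->
  transition c d (chart_map c x) = chart_map d x.
Proof.
move=> cx; rewrite /transition /in_chart.
set P := (X in xget _ X).
have [u [cu eu] <-] : P (xget 0 P).
  by apply: xgetPex; exists (chart_map d x); exists x.
by congr chart_map; apply: (@atlas_inj _ _ M c); rewrite ?inE.
Qed.

Lemma near_chart_img c x (P : 'rV[R]_n -> Prop) (U : set M) : open U ->
  U `<=` chart_dom c -> U x -> (forall y, U y -> P (chart_map c y)) ->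
  \forall z \near chart_map c x, P z.
Proof.
move=> oU Uc Ux HP.
apply: (near_open (D := chart_map c @` U)); first exact: atlas_open_map.
  by exists x.
by move=> _ [y Uy <-]; exact: HP.
Qed.

Lemma transition_differentiable c d x : chart_dom c x -> chart_dom d x ->
  differentiable (transition c d) (chart_map c x).
Proof.
move=> cx dx; apply: (smooth_differentiable (@atlas_smooth _ _ M c d)).
by exists x.
Qed.

Lemma derive_transition_id c x v : chart_dom c x ->
  'D_v (transition c c) (chart_map c x) = v.
Proof.
move=> cx; rewrite -[RHS](derive_id (chart_map c x) v).
apply: near_eq_derive; apply: (near_chart_img (U := chart_dom c)) => //.
  exact: atlas_open.
by move=> y cy; rewrite transitionE.
Qed.

(** Near the image of [x], the transition from [c] to [e] factors through [d]. *)
Lemma derive_transition_comp c d e x v :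
  chart_dom c x -> chart_dom d x -> chart_dom e x ->
  'D_v (transition c e) (chart_map c x) =
  'D_('D_v (transition c d) (chart_map c x)) (transition d e) (chart_map d x).
Proof.
move=> cx dx ex.
have E : 'D_v (transition c e) (chart_map c x) =
    'D_v (transition d e \o transition c d) (chart_map c x).
  apply: near_eq_derive.
  apply: (near_chart_img (U := chart_dom c `&` (chart_dom d `&` chart_dom e))) => //.
  - by do 2![apply: openI; first exact: atlas_open]; exact: atlas_open.
  - by move=> y [cy [dy ey]] /=; rewrite !transitionE.
apply: (etrans E).
have tx := transitionE d cx.
move: (transition_differentiable cx dx) (transition_differentiable dx ex).
rewrite -tx; exact: derive_comp.
Qed.

Lemma derive_row_expand m (W : normedModType R) (f : 'rV[R]_m -> W) z v :
  differentiable f z -> 'D_v f z = \sum_(b < m) v 0 b *: 'D_(delta_mx 0 b) f z.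
Proof.
move=> df; rewrite deriveE// {1}[v]row_sum_delta linear_sum.
by apply: eq_bigr => b _; rewrite linearZ deriveE.
Qed.

(** Every [p] is the component vector, in the chart [c], of some covector at
    [x].  Its components in the other charts are forced by the transition law,
    which is consistent by the chain rule. *)
Section Covector.
Variables (c : chart (atlas M)) (x : M) (p : 'rV[R]_n).
Hypothesis cx : chart_dom c x.

(** The value outside the domain of the chart [d] is the normalization that the
    type [cotangent] imposes. *)
Definition covector_momentum d : 'rV[R]_n :=
  if `[< chart_dom d x >] then
    \row_a \sum_(b < n)
      'D_(delta_mx 0 a) (transition d c) (chart_map d x) 0 b * p 0 b
  else 0.

Lemma covector_transition d e : chart_dom d x -> chart_dom e x ->
  forall a : 'I_n, covector_momentum d 0 a =
    \sum_(b < n) 'D_(delta_mx 0 a) (transition d e) (chart_map d x) 0 b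
                 * covector_momentum e 0 b.
Proof.
move=> dx ex a; rewrite /covector_momentum !asboolT// mxE.
under [in RHS]eq_bigr => b _ do rewrite mxE mulr_sumr.
rewrite exchange_big; apply: eq_bigr => k _ /=.
rewrite (derive_transition_comp _ dx ex cx).
rewrite derive_row_expand; last exact: transition_differentiable.
rewrite summxE mulr_suml; apply: eq_bigr => b _.
by rewrite mxE mulrA.
Qed.

Lemma covector_out d : ~ chart_dom d x -> covector_momentum d = 0.
Proof. by move=> dx; rewrite /covector_momentum asboolF. Qed.

Definition covector : cotangent M :=
  @Cotangent R n M x covector_momentum covector_transition covector_out.

Lemma momentum_covector : momentum covector c = p.
Proof.
rewrite /= /covector_momentum asboolT//; apply/rowP => a; rewrite mxE.
under eq_bigr => b _ do rewrite derive_transition_id// mxE eqxx/=.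
rewrite (bigD1 a)//= eqxx mul1r big1 ?addr0// => b /negPf ba.
by rewrite ba mul0r.
Qed.

End Covector.

(** By [momentum_covector], this image is the whole product of the image of the
    chart of the base with the nonzero vectors. *)
Lemma open_slit_chart_img (c : chart (slit_charts M)) : open (chart_img c).
Proof.
have -> : chart_img c =
    [set z | (@chart_map _ _ _ (atlas M) c @` @chart_dom _ _ _ (atlas M) c) z.1
             /\ z.2 != 0].
  apply/seteqP; split=> [_ [u [cu pu]] <- /=|[_ p] /= [[x cx <-] p0]].
    by split=> //; exists (base u).
  have E := momentum_covector p cx.
  exists (covector p cx); last by rewrite -[in RHS]E.
  by split=> //; rewrite E.
rewrite [X in open X](_ : _ =
  (fst @^-1` (@chart_map _ _ _ (atlas M) c @` @chart_dom _ _ _ (atlas M) c)) `&`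
  (snd @^-1` [set p | p != 0])) //.
apply: openI.
  apply: open_comp; first by move=> z _; exact: cvg_fst.
  by apply: atlas_open_map => //; exact: atlas_open.
apply: open_comp; first by move=> z _; exact: cvg_snd.
rewrite (_ : [set p | _] = (fun p : 'rV[R]_n => `|p|) @^-1` [set r | r != 0]).
  by apply: open_comp; [move=> z _; exact: norm_continuous|exact: open_neq].
by apply/seteqP; split=> p /=; rewrite normr_eq0.
Qed.

End SlitImage.

(** * Brackets of smooth fields in a chart *)
Section SmoothOps.
Context {R : realType} {V W : normedModType R}.
Variables (D : set V) (oD : open D).
Implicit Types (f g : V -> W).

Lemma smooth_cst (w : W) : smooth_on D (cst w).
Proof. by move=> k; exact: class_C_cst. Qed.

Lemma smooth_add f g : smooth_on D f -> smooth_on D g ->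
  smooth_on D (fun z => f z + g z).
Proof. by move=> sf sg k; exact: class_C_add. Qed.

Lemma smooth_sum (I : Type) (r : seq I) (F : I -> V -> W) :
  (forall i, smooth_on D (F i)) -> smooth_on D (fun z => \sum_(i <- r) F i z).
Proof. by move=> sF k; apply: class_C_sum => // i; exact: sF. Qed.

Lemma smooth_scale (a : V -> R^o) f : smooth_on D a -> smooth_on D f ->
  smooth_on D (fun z => a z *: f z).
Proof. by move=> sa sf k; exact: class_C_scale. Qed.

Lemma smooth_opp f : smooth_on D f -> smooth_on D (fun z => - f z).
Proof.
move=> sf; under eq_fun do rewrite -scaleN1r.
by apply: smooth_scale => // k; exact: class_C_cst.
Qed.

Lemma smooth_linear (U : normedModType R) (L : W -> U) f :
  linear L -> continuous L -> smooth_on D f -> smooth_on D (fun z => L (f z)).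
Proof. by move=> lL cL sf k; exact: class_C_linear. Qed.

End SmoothOps.

Section Coordinates.
Context {R : realType} {n : nat}.
Local Notation V := ('rV[R]_n * 'rV[R]_n)%type.

Definition xcoord (i : 'I_n) (w : V) : R^o := w.1 0 i.
Definition pcoord (i : 'I_n) (w : V) : R^o := w.2 0 i.

Lemma xcoord_linear i : linear (xcoord i).
Proof. by move=> a v w; rewrite /xcoord /= !mxE. Qed.

Lemma xcoordB i v w : xcoord i (v - w) = xcoord i v - xcoord i w.
Proof. by rewrite /xcoord /= !mxE. Qed.

Lemma pcoord_linear i : linear (pcoord i).
Proof. by move=> a v w; rewrite /pcoord /= !mxE. Qed.

Lemma xcoord_continuous i : continuous (xcoord i).
Proof.
move=> w; rewrite /xcoord.
apply: (@continuous_comp _ _ _ fst (fun M : 'rV[R]_n => M 0 i : R^o)).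
  exact: cvg_fst.
exact: coord_continuous.
Qed.

Lemma pcoord_continuous i : continuous (pcoord i).
Proof.
move=> w; rewrite /pcoord.
apply: (@continuous_comp _ _ _ snd (fun M : 'rV[R]_n => M 0 i : R^o)).
  exact: cvg_snd.
exact: coord_continuous.
Qed.

Lemma sum_ddp (y : 'rV[R]_n) : \sum_i y 0 i *: ddp i = (0, y) :> V.
Proof.
rewrite {2}[y]row_sum_delta.
elim/big_rec2: _ => // i w w' _ ->.
by congr pair; rewrite /= ?scaler0 ?addr0.
Qed.

Lemma sum_ddx (y : 'rV[R]_n) : \sum_i y 0 i *: ddx i = (y, 0) :> V.
Proof.
rewrite {2}[y]row_sum_delta.
elim/big_rec2: _ => // i w w' _ ->.
by congr pair; rewrite /= ?scaler0 ?addr0.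
Qed.

Lemma derive_expand (W : normedModType R) (f : V -> W) z (v : V) :
  differentiable f z ->
  'D_v f z = \sum_i v.1 0 i *: 'D_(ddx i) f z + \sum_i v.2 0 i *: 'D_(ddp i) f z.
Proof.
move=> df; rewrite deriveE//.
have {1}-> : v = \sum_i v.1 0 i *: ddx i + \sum_i v.2 0 i *: ddp i.
  by rewrite sum_ddx sum_ddp; case: v => x p; congr pair; rewrite /= ?addr0 ?add0r.
rewrite linearD !linear_sum; congr (_ + _);
  by apply: eq_bigr => i _; rewrite linearZ/= -deriveE.
Qed.

Lemma derive_expand_vertical (W : normedModType R) (f : V -> W) z (v : V) :
  differentiable f z -> v.1 = 0 -> 'D_v f z = \sum_i v.2 0 i *: 'D_(ddp i) f z.
Proof.
move=> df v0; rewrite derive_expand// v0.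
by rewrite big1 ?add0r => [//|i _]; rewrite mxE scale0r.
Qed.

(** Here the direction varies with the point, so smoothness is read off the
    expansion in the constant directions. *)
Lemma smooth_directional (D : set V) (W : normedModType R) (X : V -> V)
    (f : V -> W) : open D -> smooth_on D X -> smooth_on D f ->
  smooth_on D (fun z => 'D_(X z) f z).
Proof.
move=> oD sX sf.
apply: (@smooth_eq_on _ _ _ D (fun z => \sum_i xcoord i (X z) *: 'D_(ddx i) f z
   + \sum_i pcoord i (X z) *: 'D_(ddp i) f z)) => //.
  by move=> z Dz; rewrite -derive_expand//; exact: smooth_differentiable sf Dz.
apply: smooth_add => //; apply: smooth_sum => // i; apply: smooth_scale => //.
- exact: smooth_linear (xcoord_linear i) (@xcoord_continuous i) sX.
- exact: smooth_derive.
- exact: smooth_linear (pcoord_linear i) (@pcoord_continuous i) sX.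
- exact: smooth_derive.
Qed.

End Coordinates.

Section Bracket.
Context {R : realType} {V : normedModType R} {N : Type}.
Variables (A : charts V N) (c : chart A).
Hypothesis oU : open (chart_img c).
Local Notation U := (chart_img c).
Implicit Types (X Y : field A) (a : chart A -> V -> R^o).

Definition smooth_at_chart X := smooth_on U (X c).
Definition agree X Y := forall z, U z -> X c z = Y c z.
Definition fmul a X : field A := fun d z => a d z *: X d z.
Definition fsum (I : Type) (r : seq I) (F : I -> field A) : field A :=
  fun d z => \sum_(i <- r) F i d z.

Variable rho : field A.
Hypothesis srho : smooth_at_chart rho.
Let drho z : U z -> differentiable (rho c) z.
Proof. exact: smooth_differentiable. Qed.

Lemma bracket_eq X Y : agree X Y -> agree (lie_bracket rho X) (lie_bracket rho Y).
Proof.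
move=> XY z Uz; rewrite /lie_bracket XY//; congr (_ - _).
exact: derive_eq_on XY.
Qed.

Lemma bracketD X Y : smooth_at_chart X -> smooth_at_chart Y ->
  agree (lie_bracket rho (fadd X Y))
        (fadd (lie_bracket rho X) (lie_bracket rho Y)).
Proof.
move=> sX sY z Uz; rewrite /lie_bracket /fadd.
have dX := smooth_differentiable sX Uz; have dY := smooth_differentiable sY Uz.
have -> : 'D_(rho c z) (fun y => X c y + Y c y) z =
    'D_(rho c z) (X c) z + 'D_(rho c z) (Y c) z.
  by apply: deriveD; exact: diff_derivable.
rewrite [in X in _ - X](deriveE _ (drho Uz)) linearD -!deriveE//; try exact: drho.
by rewrite opprD addrACA.
Qed.

Lemma bracketM a X : smooth_on U (a c) -> smooth_at_chart X ->
  agree (lie_bracket rho (fmul a X))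
    (fadd (fmul (fun d z => 'D_(rho d z) (a d) z) X)
          (fmul a (lie_bracket rho X))).
Proof.
move=> sa sX z Uz; rewrite /lie_bracket /fadd /fmul.
have dX := smooth_differentiable sX Uz; have da := smooth_differentiable sa Uz.
have [_ ->] := derive_scale (rho c z) da dX.
rewrite [in X in _ - X](deriveE _ (drho Uz)) linearZ/= -deriveE//; last exact: drho.
by rewrite scalerBr addrA.
Qed.

End Bracket.

Section BracketSmooth.
Context {R : realType} {n : nat} {N : Type}.
Variables (A : charts ('rV[R]_n * 'rV[R]_n)%type N) (c : chart A).
Hypothesis oU : open (chart_img c).

Lemma smooth_bracket (X Y : field A) :
  smooth_at_chart c X -> smooth_at_chart c Y -> smooth_at_chart c (lie_bracket X Y).
Proof.
move=> sX sY; apply: smooth_add => //; first exact: smooth_directional.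
by apply: smooth_opp => //; exact: smooth_directional.
Qed.

End BracketSmooth.

(** * The Hamiltonian field and the tangent structure in a chart *)
Section HamiltonChart.
Context {R : realType} {n : nat}.
Variables (M : smooth_manifold R n) (H : cotangent M -> R).
Hypothesis hH : hamilton_space H.
Variable c : chart (slit_charts M).
Local Notation V := ('rV[R]_n * 'rV[R]_n)%type.
Local Notation U := (chart_img c).
Local Notation rho := (hamiltonian_field H).
Local Notation J := (tangent_structure H).
Local Notation sm := (smooth_at_chart c).
Implicit Types (X Y : field (slit_charts M)) (a : chart (slit_charts M) -> V -> R^o).

Let oU : open U := @open_slit_chart_img R n M c.

Lemma g_up_smooth i j : smooth_on U (fun z => g_up H c z i j : R^o).
Proof.
under eq_fun do rewrite mxE.
by do 2![apply: smooth_derive]; exact: (hamilton_smooth hH c).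
Qed.

Lemma g_up_unit z : U z -> g_up H c z \in unitmx.
Proof. by move=> Uz; rewrite -row_full_unit; apply/eqP/(hamilton_rank hH Uz). Qed.

Lemma g_down_smooth i j : smooth_on U (fun z => g_down H c z i j : R^o).
Proof.
move=> k; apply: class_C_invmx => //; first exact: g_up_unit.
by move=> a b; exact: g_up_smooth.
Qed.

Lemma hamiltonian_field_smooth : sm rho.
Proof.
apply: smooth_sum => // i; apply: smooth_add => //; last apply: smooth_opp => //.
  apply: smooth_scale => //; last exact: smooth_cst.
  by apply: smooth_derive; exact: (hamilton_smooth hH c).
apply: smooth_scale => //; last exact: smooth_cst.
by apply: smooth_derive; exact: (hamilton_smooth hH c).
Qed.

Lemma xcoord_hamiltonian_field i z : xcoord i (rho c z) = 'D_(ddp i) (in_chart c (H : _ -> R^o)) z.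
Proof.
rewrite /hamiltonian_field sumrB.
set F := in_chart _ _.
have -> : \sum_i 'D_(ddp i) F z *: ddx i = ((\row_i 'D_(ddp i) F z), 0) :> V.
  by rewrite -sum_ddx; apply: eq_bigr => k _; rewrite mxE.
have -> : \sum_i 'D_(ddx i) F z *: ddp i = (0, (\row_i 'D_(ddx i) F z)) :> V.
  by rewrite -sum_ddp; apply: eq_bigr => k _; rewrite mxE.
by rewrite /xcoord /= subr0 mxE.
Qed.

Lemma xcoord_derive (F : V -> V) z v i : differentiable F z ->
  xcoord i ('D_v F z) = 'D_v (fun y => xcoord i (F y)) z.
Proof.
move=> dF; apply/esym.
by have [] := derive_linear v (xcoord_linear i) (@xcoord_continuous _ _ i) dF.
Qed.

(** Of the two terms of the bracket, only the derivative of [rho] along [X] has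
    an x-part; the x-part of [rho] is [dH/dp], whose derivative along the fibre
    is the Hessian of [H]. *)
Lemma bracket_vertical X z : sm X ->
  (forall y, U y -> (X c y).1 = 0) -> U z ->
  (lie_bracket rho X c z).1 = - ((X c z).2 *m g_up H c z).
Proof.
move=> sX vX Uz; have dr := smooth_differentiable hamiltonian_field_smooth Uz.
have dX := smooth_differentiable sX Uz.
have E1 i : xcoord i ('D_(rho c z) (X c) z) = 0.
  rewrite (xcoord_derive _ i dX) (@derive_eq_on _ _ _ U _ (cst 0))//.
    exact: derive_cst.
  by move=> y Uy; rewrite /xcoord vX// mxE.
have E2 i : xcoord i ('D_(X c z) (rho c) z) = ((X c z).2 *m g_up H c z) 0 i.
  rewrite (xcoord_derive _ i dr).
  have -> : (fun y => xcoord i (rho c y)) = 'D_(ddp i) (in_chart c (H : _ -> R^o)).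
    by apply/funext => y; exact: xcoord_hamiltonian_field.
  have dH : differentiable ('D_(ddp i) (in_chart c (H : _ -> R^o))) z.
    apply: smooth_differentiable Uz; apply: smooth_derive.
    exact: (hamilton_smooth hH c).
  rewrite (derive_expand_vertical dH (vX z Uz)) mxE.
  by apply: eq_bigr => j _; rewrite [X in _ = _ * X]mxE.
apply/rowP => i; rewrite [RHS]mxE -(E2 i) -[RHS]add0r -(E1 i).
exact: xcoordB.
Qed.

Lemma tangent_structureE X z : J X c z = (0, (X c z).1 *m g_down H c z).
Proof.
rewrite /tangent_structure exchange_big/= -sum_ddp; apply: eq_bigr => j _.
rewrite -scaler_suml mxE; congr (_ *: _); apply: eq_bigr => i _; exact: mulrC.
Qed.

Lemma tangent_structure_smooth X : sm X -> sm (J X).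
Proof.
move=> sX; apply: smooth_sum => // i; apply: smooth_sum => // j.
apply: smooth_scale => //; last exact: smooth_cst.
apply: (@smooth_scale _ _ R^o) => //; first exact: g_down_smooth.
exact: smooth_linear (xcoord_linear i) (@xcoord_continuous _ _ i) sX.
Qed.

Lemma tangent_structure_kernel X z : U z -> J X c z = 0 -> (X c z).1 = 0.
Proof.
move=> Uz; rewrite tangent_structureE => -[] E.
by rewrite -[LHS]mulmx1 -(mulVmx (g_up_unit Uz)) mulmxA E mul0mx.
Qed.

Lemma tangent_structureD X Y z : J (fadd X Y) c z = J X c z + J Y c z.
Proof. by rewrite !tangent_structureE /fadd/= mulmxDl; congr pair; rewrite addr0. Qed.

Lemma tangent_structureM a X z : J (fmul a X) c z = a c z *: J X c z.
Proof. by rewrite !tangent_structureE /fmul/= -scalemxAl; congr pair; rewrite scaler0. Qed.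

Lemma tangent_structure_eq X Y z : X c z = Y c z -> J X c z = J Y c z.
Proof. by move=> XY; rewrite !tangent_structureE XY. Qed.

End HamiltonChart.

(** * The connection of a Lie derivative and an adapted structure *)
Section InducedConnection.
Context {R : realType} {V : normedModType R} {P : Type}.
Variables (A : charts V P) (c : chart A).
Hypothesis oU : open (chart_img c).
Local Notation U := (chart_img c).
Local Notation sm := (smooth_at_chart c).
Local Notation agree := (agree c).
Implicit Types (X Y : field A) (a : chart A -> V -> R^o).

Definition in_kernel (J : field A -> field A) X := forall z, U z -> J X c z = 0.

(** What the formal argument uses of the Lie derivative [L] along a field, of
    the derivative [d] of functions along it and of the tangent structure [J];
    the last link between them is the compatibility [lie_vertical]. *)
Record adapted_structure (L J : field A -> field A)
    (d : (chart A -> V -> R^o) -> chart A -> V -> R^o) : Prop := AdaptedStructure {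
  lie_smooth : forall X, sm X -> sm (L X);
  lie_local : forall X Y, agree X Y -> agree (L X) (L Y);
  lie_add : forall X Y, sm X -> sm Y -> agree (L (fadd X Y)) (fadd (L X) (L Y));
  lie_leibniz : forall a X, smooth_on U (a c) -> sm X ->
    agree (L (fmul a X)) (fadd (fmul (d a) X) (fmul a (L X)));
  J_smooth : forall X, sm X -> sm (J X);
  J_pointwise : forall X Y z, X c z = Y c z -> J X c z = J Y c z;
  J_add : forall X Y z, J (fadd X Y) c z = J X c z + J Y c z;
  J_mul : forall a X z, J (fmul a X) c z = a c z *: J X c z;
  J_square : forall X z, J (J X) c z = 0;
  lie_vertical : forall X, sm X -> in_kernel J X -> agree (J (L X)) (fopp X);
  d_smooth : forall a, smooth_on U (a c) -> smooth_on U (d a c)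
}.

Variables (L J : field A -> field A)
  (d : (chart A -> V -> R^o) -> chart A -> V -> R^o).
Hypothesis S : adapted_structure L J d.
Local Notation vertical := (in_kernel J).

Definition induced_connection X : field A :=
  fopp (fadd (L (J X)) (fopp (J (L X)))).
Local Notation N := induced_connection.
Local Notation h := (horizontal_projector N).
Local Notation v := (vertical_projector N).

Lemma smooth_fadd X Y : sm X -> sm Y -> sm (fadd X Y).
Proof. by move=> sX sY; exact: smooth_add. Qed.

Lemma smooth_fopp X : sm X -> sm (fopp X).
Proof. by move=> sX; exact: smooth_opp. Qed.

Lemma smooth_fscale (k : R) X : sm X -> sm (fscale k X).
Proof. by move=> sX; apply: smooth_scale => // i; exact: class_C_cst. Qed.

Lemma smooth_fmul a X : smooth_on U (a c) -> sm X -> sm (fmul a X).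
Proof. by move=> sa sX; exact: smooth_scale. Qed.

Lemma smooth_fsum (I : Type) (r : seq I) (F : I -> field A) :
  (forall i, sm (F i)) -> sm (fsum r F).
Proof. by move=> sF; exact: smooth_sum. Qed.

Lemma smooth_cst_fun (k : R) : smooth_on U ((fun _ _ => k : R^o) c).
Proof. by move=> i; exact: class_C_cst. Qed.

Lemma smooth_agree X Y : agree X Y -> sm X -> sm Y.
Proof. by move=> XY; exact: smooth_eq_on. Qed.

Lemma J0 X z : X c z = 0 -> J X c z = 0.
Proof.
move=> X0; rewrite (J_pointwise S (Y := fmul (fun _ _ => 0) X)).
  by rewrite (J_mul S) scale0r.
by rewrite X0 /fmul scale0r.
Qed.

Lemma J_opp X z : J (fopp X) c z = - J X c z.
Proof.
rewrite (J_pointwise S (Y := fmul (fun _ _ => -1) X)).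
  by rewrite (J_mul S) scaleN1r.
by rewrite /fmul scaleN1r.
Qed.

Lemma lie0 X z : agree X (fun _ _ => 0) -> U z -> L X c z = 0.
Proof.
move=> X0 Uz; have s0 : sm (fun _ _ => 0) by move=> i; exact: class_C_cst.
have E : L (fun _ _ => 0) c z = 0.
  have a0 : agree (fun _ _ => 0) (fadd (fun _ _ => 0) (fun _ _ => 0)).
    by move=> y _; rewrite /fadd addr0.
  have := lie_local S a0 Uz; rewrite (lie_add S s0 s0 Uz) /fadd.
  by move/esym/eqP; rewrite -subr_eq0 addrK => /eqP.
by rewrite (lie_local S X0 Uz).
Qed.

Lemma connectionE X z : N X c z = J (L X) c z - L (J X) c z.
Proof. by rewrite /induced_connection /fopp /fadd opprB. Qed.

Lemma connection_smooth X : sm X -> sm (N X).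
Proof.
move=> sX; apply: smooth_fopp; apply: smooth_fadd.
  by apply: (lie_smooth S); exact: (J_smooth S).
by apply: smooth_fopp; apply: (J_smooth S); exact: (lie_smooth S).
Qed.

Lemma connection_local X Y : agree X Y -> agree (N X) (N Y).
Proof.
move=> XY z Uz; rewrite !connectionE (J_pointwise S (lie_local S XY Uz)).
have JXY : agree (J X) (J Y) by move=> y Uy; apply: (J_pointwise S); exact: XY.
by rewrite (lie_local S JXY Uz).
Qed.

Lemma connection_add X Y : sm X -> sm Y -> agree (N (fadd X Y)) (fadd (N X) (N Y)).
Proof.
move=> sX sY z Uz; rewrite connectionE (J_pointwise S (lie_add S sX sY Uz)) (J_add S).
have E : agree (J (fadd X Y)) (fadd (J X) (J Y)) by move=> y _; exact: (J_add S).
rewrite (lie_local S E Uz) (lie_add S (J_smooth S sX) (J_smooth S sY) Uz).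
by rewrite /fadd !connectionE opprD addrACA.
Qed.

(** The derivatives of [a] appear with opposite signs in [J L] and [L J]. *)
Lemma connection_mul a X : smooth_on U (a c) -> sm X -> agree (N (fmul a X)) (fmul a (N X)).
Proof.
move=> sa sX z Uz; rewrite connectionE (J_pointwise S (lie_leibniz S sa sX Uz)).
rewrite (J_add S) !(J_mul S).
have E : agree (J (fmul a X)) (fmul a (J X)) by move=> y _; exact: (J_mul S).
rewrite (lie_local S E Uz) (lie_leibniz S sa (J_smooth S sX) Uz).
by rewrite /fadd /fmul connectionE opprD addrACA subrr add0r scalerBr.
Qed.

Lemma connection_vertical X : sm X -> vertical X -> agree (N X) (fopp X).
Proof.
by move=> sX vX z Uz; rewrite connectionE (lie0 vX Uz) subr0 (lie_vertical S sX vX Uz).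
Qed.

(** [J L J = - J], as [J X] is vertical. *)
Lemma J_connection X : sm X -> agree (J (N X)) (J X).
Proof.
move=> sX z Uz; rewrite /induced_connection J_opp (J_add S) J_opp (J_square S).
have vJ : vertical (J X) by move=> y _; exact: (J_square S).
by rewrite (lie_vertical S (J_smooth S sX) vJ Uz) /fopp oppr0 addr0 opprK.
Qed.

Lemma half_add_half : 2^-1 + 2^-1 = 1 :> R.
Proof. by rewrite [RHS](splitr 1) div1r. Qed.

Lemma projector_sum X : fadd (h X) (v X) = X.
Proof.
apply/funext => e; apply/funext => z.
rewrite /fadd /horizontal_projector /vertical_projector /fscale /fadd /fopp.
by rewrite -scalerDr addrACA subrr addr0 scalerDr -scalerDl half_add_half scale1r.
Qed.

Lemma hproj_smooth X : sm X -> sm (h X).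
Proof.
by move=> sX; apply: smooth_fscale; apply: smooth_fadd => //; exact: connection_smooth.
Qed.

Lemma vproj_smooth X : sm X -> sm (v X).
Proof.
move=> sX; apply: smooth_fscale; apply: smooth_fadd => //; apply: smooth_fopp.
exact: connection_smooth.
Qed.

Lemma hproj_local X Y : agree X Y -> agree (h X) (h Y).
Proof.
by move=> XY z Uz; rewrite /horizontal_projector /fscale /fadd XY// (connection_local XY).
Qed.

Lemma vproj_local X Y : agree X Y -> agree (v X) (v Y).
Proof.
by move=> XY z Uz; rewrite /vertical_projector /fscale /fadd /fopp XY// (connection_local XY).
Qed.

Lemma hproj_add X Y : sm X -> sm Y -> agree (h (fadd X Y)) (fadd (h X) (h Y)).
Proof.
move=> sX sY z Uz; rewrite /horizontal_projector /fscale {1}/fadd (connection_add sX sY Uz).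
by rewrite /fadd -scalerDr [in RHS]addrACA.
Qed.

Lemma vproj_add X Y : sm X -> sm Y -> agree (v (fadd X Y)) (fadd (v X) (v Y)).
Proof.
move=> sX sY z Uz; rewrite /vertical_projector /fscale /fopp {1}/fadd (connection_add sX sY Uz).
by rewrite /fadd -scalerDr [in RHS]addrACA opprD.
Qed.

Lemma hproj_mul a X : smooth_on U (a c) -> sm X -> agree (h (fmul a X)) (fmul a (h X)).
Proof.
move=> sa sX z Uz; rewrite /horizontal_projector /fscale /fadd (connection_mul sa sX Uz).
by rewrite /fmul -scalerDr !scalerA mulrC.
Qed.

Lemma vproj_mul a X : smooth_on U (a c) -> sm X -> agree (v (fmul a X)) (fmul a (v X)).
Proof.
move=> sa sX z Uz; rewrite /vertical_projector /fscale /fadd /fopp (connection_mul sa sX Uz).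
by rewrite /fmul -scalerBr !scalerA mulrC.
Qed.

Lemma hproj_vertical X : sm X -> vertical X -> agree (h X) (fun _ _ => 0).
Proof.
move=> sX vX z Uz; rewrite /horizontal_projector /fscale /fadd (connection_vertical sX vX Uz).
by rewrite /fopp subrr scaler0.
Qed.

Lemma vproj_vertical X : sm X -> vertical X -> agree (v X) X.
Proof.
move=> sX vX z Uz; rewrite -[in RHS](projector_sum X) /fadd.
by rewrite (hproj_vertical sX vX Uz) add0r.
Qed.

Lemma vertical_vproj X : sm X -> vertical (v X).
Proof.
move=> sX z Uz.
rewrite (J_pointwise S (Y := fmul (fun _ _ => 2^-1) (fadd X (fopp (N X)))))//.
by rewrite (J_mul S) (J_add S) J_opp (J_connection sX Uz) subrr scaler0.
Qed.

(** Apply [v] to [X = h X + v X] and use that [v] fixes the vertical [v X]. *)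
Lemma vproj_hproj X : sm X -> agree (v (h X)) (fun _ _ => 0).
Proof.
move=> sX z Uz; have := vproj_add (hproj_smooth sX) (vproj_smooth sX) Uz.
rewrite projector_sum /fadd (vproj_vertical (vproj_smooth sX) (vertical_vproj sX) Uz).
by move/esym/eqP; rewrite -subr_eq0 addrK => /eqP.
Qed.

Definition induced_derivative X : field A := fadd (h (L (h X))) (v (L (v X))).
Definition induced_jacobi X : field A := v (fadd (L (h X)) (fopp (h (L X)))).
Local Notation nabla := induced_derivative.
Local Notation Phi := induced_jacobi.

Lemma nabla_local X Y : agree X Y -> agree (nabla X) (nabla Y).
Proof.
move=> XY z Uz; rewrite /induced_derivative /fadd.
rewrite (hproj_local (lie_local S (hproj_local XY)) Uz).
by rewrite (vproj_local (lie_local S (vproj_local XY)) Uz).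
Qed.

(** For a vertical field the horizontal half of the derivative vanishes. *)
Lemma nabla_vertical X : sm X -> vertical X -> agree (nabla X) (v (L X)).
Proof.
move=> sX vX z Uz; rewrite /induced_derivative /fadd.
rewrite (vproj_local (lie_local S (vproj_vertical sX vX)) Uz).
have E : agree (h (L (h X))) (fun _ _ => 0).
  have Lh0 : agree (L (h X)) (fun _ _ => 0).
    by move=> y Uy; exact: lie0 (hproj_vertical sX vX) Uy.
  have s0 : sm (fun _ _ => 0) by move=> i; exact: class_C_cst.
  have v0 : vertical (fun _ _ => 0) by move=> y _; exact: J0.
  by move=> y Uy; rewrite (hproj_local Lh0 Uy) (hproj_vertical s0 v0 Uy).
by rewrite E// add0r.
Qed.

(** The term [h L X] of the Lie derivative of [h] is killed by [v]. *)
Lemma jacobiE X : sm X -> agree (Phi X) (v (L (h X))).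
Proof.
move=> sX z Uz; have sL := lie_smooth S sX; have sh := hproj_smooth sL.
rewrite /induced_jacobi (vproj_add (lie_smooth S (hproj_smooth sX)) (smooth_fopp sh) Uz) /fadd.
have E : agree (fopp (h (L X))) (fmul (fun _ _ => -1) (h (L X))).
  by move=> y _; rewrite /fmul scaleN1r.
rewrite (vproj_local E Uz) (vproj_mul (smooth_cst_fun (-1)) sh Uz).
by rewrite /fmul (vproj_hproj sL Uz) scaler0 addr0.
Qed.

Lemma vertical_jacobi X : sm X -> vertical (Phi X).
Proof.
move=> sX z Uz; have sL := lie_smooth S (hproj_smooth sX).
by rewrite (J_pointwise S (jacobiE sX Uz)) (vertical_vproj sL Uz).
Qed.

Lemma jacobi_local X Y : sm X -> agree X Y -> agree (Phi X) (Phi Y).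
Proof.
move=> sX XY z Uz; rewrite (jacobiE sX Uz) (jacobiE (smooth_agree XY sX) Uz).
exact: (vproj_local (lie_local S (hproj_local XY)) Uz).
Qed.

Lemma jacobi_add X Y : sm X -> sm Y -> agree (Phi (fadd X Y)) (fadd (Phi X) (Phi Y)).
Proof.
move=> sX sY z Uz; rewrite (jacobiE (smooth_fadd sX sY) Uz) /fadd.
rewrite (jacobiE sX Uz) (jacobiE sY Uz).
have sLX := lie_smooth S (hproj_smooth sX); have sLY := lie_smooth S (hproj_smooth sY).
rewrite (vproj_local (lie_local S (hproj_add sX sY)) Uz).
rewrite (vproj_local (lie_add S (hproj_smooth sX) (hproj_smooth sY)) Uz).
exact: vproj_add.
Qed.

(** The Leibniz rule produces an extra multiple of [h X], which [v] kills. *)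
Lemma jacobi_mul a X : smooth_on U (a c) -> sm X ->
  agree (Phi (fmul a X)) (fmul a (Phi X)).
Proof.
move=> sa sX z Uz; rewrite (jacobiE (smooth_fmul sa sX) Uz) /fmul (jacobiE sX Uz).
have sh := hproj_smooth sX; have sL := lie_smooth S sh.
rewrite (vproj_local (lie_local S (hproj_mul sa sX)) Uz).
rewrite (vproj_local (lie_leibniz S sa sh) Uz).
have sda := d_smooth S sa.
rewrite (vproj_add (smooth_fmul sda sh) (smooth_fmul sa sL) Uz) /fadd.
rewrite (vproj_mul sda sh Uz) (vproj_mul sa sL Uz) /fmul.
by rewrite (vproj_hproj sX Uz) scaler0 add0r.
Qed.

Lemma jacobi_vertical X : sm X -> vertical X -> agree (Phi X) (fun _ _ => 0).
Proof.
move=> sX vX z Uz; rewrite (jacobiE sX Uz).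
have Lh0 : agree (L (h X)) (fun _ _ => 0).
  by move=> y Uy; exact: lie0 (hproj_vertical sX vX) Uy.
have s0 : sm (fun _ _ => 0) by move=> i; exact: class_C_cst.
have v0 : vertical (fun _ _ => 0) by move=> y _; exact: J0.
by rewrite (vproj_local Lh0 Uz) (vproj_vertical s0 v0 Uz).
Qed.

Lemma jacobi_sum (I : Type) (r : seq I) (F : I -> field A) : (forall i, sm (F i)) ->
  agree (Phi (fsum r F)) (fsum r (fun i => Phi (F i))).
Proof.
move=> sF; elim: r => [|i r IH] z Uz.
  have s0 : sm (fsum [::] F) by exact: smooth_fsum.
  rewrite (jacobi_vertical s0 _ Uz) /fsum ?big_nil// => y _.
  by apply: J0; rewrite /fsum big_nil.
have E : agree (fsum (i :: r) F) (fadd (F i) (fsum r F)).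
  by move=> y _; rewrite /fsum big_cons.
rewrite (jacobi_local (smooth_fsum (i :: r) sF) E Uz).
rewrite (jacobi_add (sF i) (smooth_fsum r sF) Uz) /fadd (IH z Uz).
by rewrite /fsum big_cons.
Qed.

(** Both terms have the form [v L Y]: the first with [Y = v X], because
    [N X = - L J X] for a Newtonoid field gives [nabla (J X) = v X], the second
    with [Y = h X].  They add up to [v L X], and [L X] is vertical. *)
Lemma second_derivative_newtonoid X : sm X -> vertical (L X) ->
  agree (fadd (nabla (nabla (J X))) (Phi X)) (L X).
Proof.
move=> sX vLX z Uz.
have sJ := J_smooth S sX; have sL := lie_smooth S sX.
have sv := vproj_smooth sX; have sh := hproj_smooth sX.
have vJ : vertical (J X) by move=> y _; exact: (J_square S).
(* [L J X = - N X], and [N = h - v]. *)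
have LJ : agree (L (J X)) (fadd (v X) (fmul (fun _ _ => -1) (h X))).
  move=> y Uy; have := connectionE X y; rewrite vLX// sub0r => NX.
  rewrite -[LHS]opprK -NX /fadd /fmul scaleN1r.
  rewrite /horizontal_projector /vertical_projector /fscale /fadd /fopp.
  rewrite -scalerBr opprD addrACA subrr add0r.
  by rewrite scalerDr -scalerDl half_add_half scale1r.
have sNh := smooth_fmul (smooth_cst_fun (-1)) sh.
have E : agree (nabla (J X)) (v X).
  move=> y Uy; rewrite (nabla_vertical sJ vJ Uy) (vproj_local LJ Uy).
  rewrite (vproj_add sv sNh Uy) /fadd (vproj_vertical sv (vertical_vproj sX) Uy).
  by rewrite (vproj_mul (smooth_cst_fun (-1)) sh Uy) /fmul (vproj_hproj sX Uy) scaler0 addr0.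
rewrite /fadd (nabla_local E Uz) (nabla_vertical sv (vertical_vproj sX) Uz).
rewrite (jacobiE sX Uz) addrC.
have sLh := lie_smooth S sh; have sLv := lie_smooth S sv.
have F : agree (L X) (fadd (L (h X)) (L (v X))).
  by move=> y Uy; rewrite -(lie_add S sh sv Uy) projector_sum.
rewrite -[LHS](vproj_add sLh sLv Uz) -(vproj_local F Uz).
exact: vproj_vertical.
Qed.

End InducedConnection.

(** * Hamilton spaces *)
Section HamiltonSpace.
Context {R : realType} {n : nat}.
Variables (M : smooth_manifold R n) (H : cotangent M -> R).
Hypothesis hH : hamilton_space H.
Variable c : chart (slit_charts M).
Local Notation V := ('rV[R]_n * 'rV[R]_n)%type.
Local Notation U := (chart_img c).
Local Notation rho := (hamiltonian_field H).
Local Notation J := (tangent_structure H).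
Local Notation sm := (smooth_at_chart c).
Implicit Types (X Y : field (slit_charts M)) (a : chart (slit_charts M) -> V -> R^o).

Let oU : open U := @open_slit_chart_img R n M c.

Definition rho_derivative a : chart (slit_charts M) -> V -> R^o :=
  fun d z => 'D_(rho d z) (a d) z.

(** The compatibility of [J] with the bracket is the computation of
    [bracket_vertical]: [J] multiplies by the inverse of the Hessian. *)
Lemma hamilton_adapted : adapted_structure c (lie_bracket rho) J rho_derivative.
Proof.
have sr := hamiltonian_field_smooth hH c.
split.
- by move=> X sX; exact: smooth_bracket.
- by move=> X Y XY; exact: bracket_eq.
- by move=> X Y sX sY; exact: bracketD.
- by move=> a X sa sX; exact: bracketM.
- by move=> X sX; exact: (tangent_structure_smooth hH).
- by move=> X Y z XY; exact: tangent_structure_eq.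
- by move=> X Y z; exact: tangent_structureD.
- by move=> a X z; exact: tangent_structureM.
- by move=> X z; rewrite !tangent_structureE /= mul0mx.
- move=> X sX JX0 z Uz.
  have vX y : U y -> (X c y).1 = 0.
    by move=> Uy; exact: (tangent_structure_kernel hH Uy (JX0 y Uy)).
  rewrite tangent_structureE (bracket_vertical hH sX vX Uz) mulNmx -mulmxA.
  rewrite mulmxV ?(g_up_unit hH)// mulmx1 /fopp.
  by case: (X c z) (vX z Uz) => x p /= ->; congr pair; rewrite oppr0.
- by move=> a sa; exact: smooth_directional.
Qed.

Let S := hamilton_adapted.
Local Notation Phi := (induced_jacobi (lie_bracket rho) J).

(** Decompose [X] into the coordinate fields [d/dx^i] with coefficients [X^i]
    and a vertical field. *)
Lemma jacobi_components X z : sm X -> U z ->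
  Phi X c z = \sum_(i < n) \sum_(j < n)
    (jacobi_coef Phi c z i j * (X c z).1 0 i) *: ddp j.
Proof.
move=> sX Uz.
pose E i : field (slit_charts M) := fun _ _ => ddx i.
pose x i : chart (slit_charts M) -> V -> R^o := fun d z => xcoord i (X d z).
pose Y : field (slit_charts M) := fun d z => \sum_i pcoord i (X d z) *: ddp i.
have sE i : sm (E i) by exact: smooth_cst.
have sx i : smooth_on U (x i c).
  exact: smooth_linear (xcoord_linear i) (@xcoord_continuous _ _ i) sX.
have sY : sm Y.
  apply: smooth_sum => // i; apply: smooth_scale => //; last exact: smooth_cst.
  exact: smooth_linear (pcoord_linear i) (@pcoord_continuous _ _ i) sX.
have vY : in_kernel c J Y.
  by move=> y _; rewrite tangent_structureE /Y sum_ddp /= mul0mx.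
pose F i := fmul (x i) (E i).
have sF i : sm (F i) by exact: smooth_fmul.
have XE : agree c X (fadd (fsum (index_enum 'I_n) F) Y).
  move=> y _; rewrite /fadd /fsum /F /fmul /Y sum_ddp.
  rewrite -[X in X + _]/(\sum_i (X c y).1 0 i *: ddx i) sum_ddx.
  by case: (X c y) => ? ?; congr pair; rewrite /= ?addr0 ?add0r.
rewrite (jacobi_local oU S sX XE Uz).
rewrite (jacobi_add oU S (smooth_fsum oU _ sF) sY Uz) /fadd.
rewrite (jacobi_vertical oU S sY vY Uz) addr0 (jacobi_sum oU S _ sF Uz) /fsum.
apply: eq_bigr => i _; rewrite (jacobi_mul oU S (sx i) (sE i) Uz) /fmul.
have vP : (Phi (E i) c z).1 = 0.
  exact: (tangent_structure_kernel hH Uz (vertical_jacobi oU S (sE i) Uz)).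
have -> : Phi (E i) c z = \sum_j (Phi (E i) c z).2 0 j *: ddp j.
  by rewrite sum_ddp -vP -surjective_pairing.
rewrite scaler_sumr; apply: eq_bigr => j _.
by rewrite scalerA mulrC.
Qed.

End HamiltonSpace.

Theorem proposition4 (R : realType) (n : nat) (M : smooth_manifold R n)
    (H : cotangent M -> R) (hH : hamilton_space H)
    (X : field (slit_charts M)) (hX : vector_field X) :
  let rho := hamiltonian_field H in
  let J := tangent_structure H in
  let N := canonical_connection H in
  let nabla := dynamical_derivative rho N in
  let Phi := jacobi_endomorphism rho N in
  let lhs := fadd (nabla (nabla (J X))) (Phi X) in
  let local_lhs : field (slit_charts M) :=
    fadd
      (nabla (nabla (fun c z => \sum_(i < n) \sum_(j < n)
         (g_down H c z i j * (X c z).1 0 i) *: ddp j)))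
      (fun c z => \sum_(i < n) \sum_(j < n)
         (jacobi_coef Phi c z i j * (X c z).1 0 i) *: ddp j) in
  (infinitesimal_symmetry rho X <-> newtonoid rho J X /\ vanishes lhs) /\
  (forall c z, chart_img c z -> lhs c z = local_lhs c z).
Proof.
move=> rho J N nabla Phi lhs local_lhs.
have sX c : smooth_at_chart c X by case: hX => sX _; exact: sX.
have key : newtonoid rho J X -> forall c z, chart_img c z ->
    lhs c z = lie_bracket rho X c z.
  move=> nX c z Uz.
  exact: (second_derivative_newtonoid (@open_slit_chart_img R n M c)
           (hamilton_adapted hH c) (sX c) (nX c) Uz).
split; last first.
  move=> c z Uz; rewrite /lhs /local_lhs /fadd; congr (_ + _).
  exact: (jacobi_components hH (sX c) Uz).
split=> [symX|[nX lX] c z Uz]; last by rewrite -(key nX c z Uz); exact: lX.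
have nX : newtonoid rho J X.
  by move=> c z Uz; apply: (J0 (hamilton_adapted hH c)); exact: symX.
by split=> // c z Uz; rewrite (key nX c z Uz); exact: symX.
Qed.
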